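(* Let $0<\mu<L$ and let $f\in\mathcal S_{\mu,L}$, i.e. $f:\mathbb{R}^{d_x}\times\mathbb{R}^{d_y}\to\mathbb{R}$ is convex--concave, $\mu$-strongly-convex-$\mu$-strongly-concave and $L$-smooth. For $z_0=(x_0,y_0)$ and $z_1=(x_1,y_1)$ put $$d(z_1,z_0):=f(z_1)-f(z_0)-\langle g^x(z_0),x_1-x_0\rangle-\langle g^y(z_1),y_1-y_0\rangle .$$ Then for all $z_0=(x_0,y_0)$, $z_1=(x_1,y_1)\in\mathbb{R}^{d_x}\times\mathbb{R}^{d_y}$ the following four inequalities hold: $$0\ge \|g^z(z_1)-g^z(z_0)\|_2^2-L^2\|z_1-z_0\|_2^2,$$ $$d(z_1,z_0)\ge \frac{\mu}{2}\|z_1-z_0\|_2^2,$$ $$d(z_1,z_0)\ge \frac{1}{2(L-\mu)}\|g^x(z_1)-g^x(z_0)-\mu(x_1-x_0)\|_2^2+\frac{\mu}{2}\|x_1-x_0\|_2^2-\frac{L}{2}\|y_1-y_0\|_2^2,$$ $$d(z_1,z_0)\ge \frac{1}{2(L-\mu)}\|g^y(z_1)-g^y(z_0)+\mu(y_1-y_0)\|_2^2+\frac{\mu}{2}\|y_1-y_0\|_2^2-\frac{L}{2}\|x_1-x_0\|_2^2.$$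
   Context: A function $f:\mathbb{R}^{d_x}\times\mathbb{R}^{d_y}\to\mathbb{R}$ is convex--concave ($f\in\mathcal S$) if $f(\cdot,y)$ is convex for every $y$ and $f(x,\cdot)$ is concave for every $x$. For $z=(x,y)$, $\partial_x f(z)$ is the subdifferential of the convex function $f(\cdot,y)$ at $x$ and $\partial_y f(z)$ is the superdifferential of the concave function $f(x,\cdot)$ at $y$. An operator of $f$ is a map $g^z(z)=(g^x(z),-g^y(z))$ with $g^x(z)\in\partial_x f(z)$ and $g^y(z)\in\partial_y f(z)$. The function $f\in\mathcal S$ is $\mu$-strongly-convex-$\mu$-strongly-concave if $\langle g^z(w)-g^z(z),w-z\rangle\ge\mu\|w-z\|_2^2$ for all $z,w$, and $L$-smooth if $\|g^z(w)-g^z(z)\|_2\le L\|w-z\|_2$ for all $z,w$ (for all choices of the partial sub-/supergradients). When $f$ is $L$-smooth, $g^x(z)=\nabla_x f(z)$ and $g^y(z)=\nabla_y f(z)$. $\mathcal S_{\mu,L}$ denotes the class of all $f\in\mathcal S$ that are both $\mu$-strongly-convex-$\mu$-strongly-concave and $L$-smooth, where $0<\mu<L$. $\|\cdot\|_2$ and $\langle\cdot,\cdot\rangle$ are the Euclidean norm and inner product. *)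

(* Defs.v *)
From HB Require Import structures.
From mathcomp Require Import all_boot all_order all_algebra.
From mathcomp Require Import all_classical reals convex.

Set Implicit Arguments.
Unset Strict Implicit.
Unset Printing Implicit Defensive.

Import Order.TTheory GRing.Theory Num.Theory.

Local Open Scope classical_set_scope.
Local Open Scope ring_scope.

(* The norm of MathComp-Analysis on 'rV[R]_n and on products is the sup norm,
   so the Euclidean structure is defined here. *)
Definition inner (R : realType) (n : nat) (u v : 'rV[R]_n) : R :=
  \sum_(i < n) u 0 i * v 0 i.

Definition l2norm (R : realType) (n : nat) (u : 'rV[R]_n) : R :=
  Num.sqrt (inner u u).

Definition innerp (R : realType) (dx dy : nat)
    (z w : 'rV[R]_dx * 'rV[R]_dy) : R :=
  inner z.1 w.1 + inner z.2 w.2.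

Definition l2normp (R : realType) (dx dy : nat)
    (z : 'rV[R]_dx * 'rV[R]_dy) : R :=
  Num.sqrt (innerp z z).

Definition convex_concave (R : realType) (dx dy : nat)
    (f : 'rV[R]_dx * 'rV[R]_dy -> R) : Prop :=
  (forall y, convex_function setT (fun x => f (x, y))) /\
  (forall x, convex_function setT (fun y => - f (x, y))).

Definition subdifferential_x (R : realType) (dx dy : nat)
    (f : 'rV[R]_dx * 'rV[R]_dy -> R) (z : 'rV[R]_dx * 'rV[R]_dy) :
    set 'rV[R]_dx :=
  [set g | forall x, f (x, z.2) >= f z + inner g (x - z.1)].

Definition superdifferential_y (R : realType) (dx dy : nat)
    (f : 'rV[R]_dx * 'rV[R]_dy -> R) (z : 'rV[R]_dx * 'rV[R]_dy) :
    set 'rV[R]_dy :=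
  [set g | forall y, f (z.1, y) <= f z + inner g (y - z.2)].

(* gx and gy are the partial sub-/supergradient selections from which an
   operator of f is formed; the operator itself is [operator gx gy]. *)
Definition gradient_selection (R : realType) (dx dy : nat)
    (f : 'rV[R]_dx * 'rV[R]_dy -> R)
    (gx : 'rV[R]_dx * 'rV[R]_dy -> 'rV[R]_dx)
    (gy : 'rV[R]_dx * 'rV[R]_dy -> 'rV[R]_dy) : Prop :=
  forall z, subdifferential_x f z (gx z) /\ superdifferential_y f z (gy z).

Definition operator (R : realType) (dx dy : nat)
    (gx : 'rV[R]_dx * 'rV[R]_dy -> 'rV[R]_dx)
    (gy : 'rV[R]_dx * 'rV[R]_dy -> 'rV[R]_dy)
    (z : 'rV[R]_dx * 'rV[R]_dy) : 'rV[R]_dx * 'rV[R]_dy :=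
  (gx z, - gy z).

Definition strongly_convex_concave (R : realType) (dx dy : nat) (mu : R)
    (f : 'rV[R]_dx * 'rV[R]_dy -> R) : Prop :=
  forall gx gy, gradient_selection f gx gy ->
  forall z w : 'rV[R]_dx * 'rV[R]_dy,
    innerp (operator gx gy w - operator gx gy z) (w - z)
      >= mu * l2normp (w - z) ^+ 2.

Definition smooth (R : realType) (dx dy : nat) (L : R)
    (f : 'rV[R]_dx * 'rV[R]_dy -> R) : Prop :=
  forall gx gy, gradient_selection f gx gy ->
  forall z w : 'rV[R]_dx * 'rV[R]_dy,
    l2normp (operator gx gy w - operator gx gy z) <= L * l2normp (w - z).

Definition S_class (R : realType) (dx dy : nat) (mu L : R)
    (f : 'rV[R]_dx * 'rV[R]_dy -> R) : Prop :=
  [/\ convex_concave f, strongly_convex_concave mu f & smooth L f].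

(* The x-gradient is taken at z0, the y-gradient at z1. *)
Definition gap (R : realType) (dx dy : nat)
    (f : 'rV[R]_dx * 'rV[R]_dy -> R)
    (gx : 'rV[R]_dx * 'rV[R]_dy -> 'rV[R]_dx)
    (gy : 'rV[R]_dx * 'rV[R]_dy -> 'rV[R]_dy)
    (z1 z0 : 'rV[R]_dx * 'rV[R]_dy) : R :=
  f z1 - f z0 - inner (gx z0) (z1.1 - z0.1) - inner (gy z1) (z1.2 - z0.2).

(* Main.v *)
(* Rough one-sided bounds on [f(p + v) - f p - <g p, v>] follow from the partial
   sub- and supergradients ([0] in one variable, [L |v|^2] jointly); a midpoint
   bisection sharpens them to the quadratic bounds with constants [mu / 2] and
   [L / 2], without differentiating [f].  The third inequality combines strong
   convexity of [f(., y0)] at [z0] with the descent inequality at [z1], both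
   evaluated at an intermediate point [(x', y0)], and optimizes over [x'].  The
   fourth is the third for [(y, x) |-> - f(x, y)] with [z0] and [z1] exchanged. *)
Require Import Defs.
From mathcomp Require Import all_boot all_order all_algebra.
From mathcomp Require Import unstable reals.
From mathcomp Require Import ring lra.

Import Order.TTheory GRing.Theory Num.Theory.

Local Open Scope ring_scope.

Section Halving.
Context {R : realType}.

(** If [a] were positive, the bound would fail at an integer [n] above [b / a], since
    [n < 2 ^ n]. *)
Lemma le0_expn2_bounded (a b : R) :
  (forall n : nat, a * 2 ^+ n <= b) -> a <= 0.
Proof.
move=> ab; rewrite leNgt; apply/negP => a0.
pose n := Num.bound (b / a).
have /ltW b0 : 0 < b by have := ab 0%N; rewrite expr0 mulr1; exact: lt_le_trans.
have /(le_lt_trans (ler_norm _)) : `|b / a| < n%:R.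
  by rewrite [ltLHS]ger0_norm ?archi_boundP// divr_ge0// ltW.
rewrite ltr_pdivrMr// => bn; have := le_lt_trans (ab n) bn.
rewrite mulrC ltr_pM2r// -natrX ltr_nat => /ltnW.
by rewrite leqNgt ltn_expl.
Qed.

(* The midpoint improves the constant [c] to [c / 2 + M / 4], whose fixed point
   is [M / 2]; [gv p] plays the role of the derivative at [p] in direction [v]. *)
Lemma quadratic_bound_halving (V : lmodType R) (F gv : V -> R) (v : V) (c M : R) :
  (forall p t, F (p + t *: v) - F p - t * gv p <= c * t ^+ 2) ->
  (forall p t, t * (gv (p + t *: v) - gv p) <= M * t ^+ 2) ->
  forall p, F (p + v) - F p - gv p <= M / 2.
Proof.
move=> Fc gM p.
(* The excess over [M / 2 * t ^+ 2] on a segment is at most the sum of the excesses on its two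
   halves. Each half has a quarter of the bound, as [t] is halved, so every bisection gains a factor
   2. *)
have iter (n : nat) q t : (F (q + t *: v) - F q - t * gv q - M / 2 * t ^+ 2) * 2 ^+ n
    <= (c - M / 2) * t ^+ 2.
  elim: n q t => [|n IH] q t.
    by rewrite expr0; have := Fc q t; lra.
  have tE : q + t *: v = q + (t / 2) *: v + (t / 2) *: v.
    by rewrite -addrA -scalerDl -splitr.
  have := lerD (IH q (t / 2)) (IH (q + (t / 2) *: v) (t / 2)).
  rewrite -tE -mulrDl; set X := (X in X * _ <= _) => hX.
  have : F (q + t *: v) - F q - t * gv q - M / 2 * t ^+ 2 <= X.
    by have := gM q (t / 2); rewrite /X; lra.
  move=> /(ler_wpM2r (exprn_ge0 n (ler0n R 2)))/le_trans/(_ hX).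
  by rewrite (exprS _ n) [X in _ -> X <= _]mulrCA; move: (_ * 2 ^+ n) => Y; lra.
suff : F (p + v) - F p - gv p - M / 2 <= 0 by lra.
apply: (@le0_expn2_bounded _ (c - M / 2)) => n.
by have := iter n p 1; rewrite scale1r expr1n mul1r !mulr1.
Qed.

End Halving.

Section Inner.
Context {R : realType} {n : nat}.
Implicit Types u v w : 'rV[R]_n.

Lemma innerC u v : inner u v = inner v u.
Proof. by apply: eq_bigr => i _; rewrite mulrC. Qed.

Lemma innerDl u v w : inner (u + v) w = inner u w + inner v w.
Proof. by rewrite -big_split; apply: eq_bigr => i _; rewrite mxE mulrDl. Qed.

Lemma innerZl a u w : inner (a *: u) w = a * inner u w.
Proof. by rewrite mulr_sumr; apply: eq_bigr => i _; rewrite mxE mulrA. Qed.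

Lemma innerNl u w : inner (- u) w = - inner u w.
Proof. by rewrite -scaleN1r innerZl mulN1r. Qed.

Lemma innerDr u v w : inner u (v + w) = inner u v + inner u w.
Proof. by rewrite innerC innerDl !(innerC u). Qed.

Lemma innerZr a u w : inner u (a *: w) = a * inner u w.
Proof. by rewrite innerC innerZl innerC. Qed.

Lemma innerNr u w : inner u (- w) = - inner u w.
Proof. by rewrite innerC innerNl innerC. Qed.

Lemma inner0r u : inner u 0 = 0.
Proof. by rewrite -(scale0r 0) innerZr mul0r. Qed.

Definition innerE := (innerDl, innerDr, innerNl, innerNr, innerZl, innerZr).

Lemma inner_ge0 u : 0 <= inner u u.
Proof. by apply: sumr_ge0 => i _; rewrite -expr2 sqr_ge0. Qed.

Lemma sqr_l2norm u : l2norm u ^+ 2 = inner u u.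
Proof. by rewrite sqr_sqrtr// inner_ge0. Qed.

Lemma inner_young (L : R) u v : 0 < L ->
  2 * L * inner u v <= inner u u + L ^+ 2 * inner v v.
Proof.
move=> L0; have := inner_ge0 (u - L *: v).
by rewrite !innerE (innerC v u); lra.
Qed.

End Inner.

Lemma sqr_l2normp (R : realType) (dx dy : nat) (z : 'rV[R]_dx * 'rV[R]_dy) :
  l2normp z ^+ 2 = inner z.1 z.1 + inner z.2 z.2.
Proof. by rewrite sqr_sqrtr// addr_ge0// inner_ge0. Qed.

Section Saddle.
Context {R : realType} {dx dy : nat} {mu L : R}.
Hypotheses (mu_gt0 : 0 < mu) (mu_lt_L : mu < L).
Context {f : 'rV[R]_dx * 'rV[R]_dy -> R}.
Context {gx : 'rV[R]_dx * 'rV[R]_dy -> 'rV[R]_dx}.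
Context {gy : 'rV[R]_dx * 'rV[R]_dy -> 'rV[R]_dy}.
Hypothesis fg : gradient_selection f gx gy.
Hypothesis g_mono : forall z w, mu * l2normp (w - z) ^+ 2 <=
  innerp (operator gx gy w - operator gx gy z) (w - z).
Hypothesis g_lip : forall z w,
  l2normp (operator gx gy w - operator gx gy z) <= L * l2normp (w - z).

Let L_gt0 : 0 < L. Proof. exact: lt_trans mu_lt_L. Qed.

Lemma sqr_operator_lip z w :
  l2normp (operator gx gy w - operator gx gy z) ^+ 2 <= L ^+ 2 * l2normp (w - z) ^+ 2.
Proof.
rewrite -exprMn lerXn2r ?nnegrE ?g_lip ?sqrtr_ge0//.
by rewrite mulr_ge0 ?sqrtr_ge0// ltW.
Qed.

(** Young's inequality with weight [L] in each block, added to the squared Lipschitz bound. The sign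
    of [gy] in [operator] disappears in the norm, so the bound holds for the plain gradient
    [(gx, gy)]. *)
Lemma gradient_young z w (u : 'rV[R]_dx) (v : 'rV[R]_dy) :
  2 * (inner (gx w - gx z) u + inner (gy w - gy z) v)
  <= L * (inner (w.1 - z.1) (w.1 - z.1) + inner (w.2 - z.2) (w.2 - z.2)
          + inner u u + inner v v).
Proof.
have := sqr_operator_lip z w; rewrite !sqr_l2normp /=.
rewrite -opprD [inner (- _) _]innerNl innerNr opprK.
have := inner_young _ (gx w - gx z) u L_gt0.
have := inner_young _ (gy w - gy z) v L_gt0.
move=> hy hx hL; rewrite -(ler_pM2l L_gt0).
by move: hx hy hL; lra.
Qed.

Lemma strong_convexity_x z (u : 'rV[R]_dx) :
  mu / 2 * inner u u <= f (z.1 + u, z.2) - f z - inner (gx z) u.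
Proof.
(* Negating [f] makes the lower bound an upper one: the subgradient inequality gives [c = 0], and
   monotonicity along the first variable gives the negative [M]. *)
have := @quadratic_bound_halving _ _ (fun x => - f (x, z.2))
  (fun x => - inner (gx (x, z.2)) u) u 0 (- mu * inner u u) _ _ z.1.
rewrite -surjective_pairing => H.
suff : - f (z.1 + u, z.2) - - f z - - inner (gx z) u <= - mu * inner u u / 2 by lra.
apply: H => p t.
  have [+ _] := fg (p, z.2) => /(_ (p + t *: u)) /=.
  by rewrite addrAC subrr add0r innerZr mul0r; lra.
have := g_mono (p, z.2) (p + t *: u, z.2).
rewrite sqr_l2normp /innerp /= subrr !inner0r addrAC subrr add0r !innerE.
by lra.
Qed.

Lemma descent z (u : 'rV[R]_dx) (v : 'rV[R]_dy) :
  f (z.1 + u, z.2 + v) - f z - (inner (gx z) u + inner (gy z) v)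
  <= L / 2 * (inner u u + inner v v).
Proof.
have := @quadratic_bound_halving _ _ f
  (fun p => inner (gx p) u + inner (gy p) v) (u, v)
  (L * (inner u u + inner v v)) (L * (inner u u + inner v v)) _ _ z.
rewrite [L / 2 * _]mulrAC; apply => -[x y] t.
  (* At the corner [(x + t *: u, y)] the subgradient, tested at [x], and the supergradient, tested
     at [y + t *: v], both bound the increment of [f] from above. [gradient_young] then moves these
     gradients to [(x, y)]. *)
  have [/(_ x) hx /(_ (y + t *: v)) hy] := fg (x + t *: u, y).
  have := gradient_young (x, y) (x + t *: u, y) (t *: u) (t *: v).
  have := mulr_ge0 (ltW L_gt0) (mulr_ge0 (sqr_ge0 t) (inner_ge0 v)).
  have -> : (x, y) + t *: (u, v) = (x + t *: u, y + t *: v) by [].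
  move: hx hy; rewrite /= opprD addNKr subrr inner0r ![_ + _ *: _ - _]addrAC !subrr !add0r.
  by rewrite !innerE; lra.
have := gradient_young (x, y) (x + t *: u, y + t *: v) (t *: u) (t *: v).
have -> : (x, y) + t *: (u, v) = (x + t *: u, y + t *: v) by [].
by rewrite /= ![_ + _ *: _ - _]addrAC !subrr !add0r !innerE; lra.
Qed.

(* Pass through [(x1 + s, y0)]: strong convexity bounds [f] there from below
   and descent from [z1] bounds it from above; this [s] is the best choice. *)
Lemma gap_ge_x z0 z1 :
  1 / (2 * (L - mu)) * l2norm (gx z1 - gx z0 - mu *: (z1.1 - z0.1)) ^+ 2
  + mu / 2 * l2norm (z1.1 - z0.1) ^+ 2 - L / 2 * l2norm (z1.2 - z0.2) ^+ 2
  <= gap f gx gy z1 z0.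
Proof.
rewrite /gap !sqr_l2norm.
set D := z1.1 - z0.1; set E := z1.2 - z0.2.
(* Apart from terms free of [s], the two bounds leave [- inner w s - (L - mu) / 2 * inner s s],
   which is maximal at [s = - w / (L - mu)]. *)
set w := gx z1 - gx z0 - mu *: D; pose k := (L - mu)^-1; pose s := - (k *: w).
have := strong_convexity_x z0 (D + s); have := descent z1 s (- E).
have -> : z1.2 - E = z0.2 by rewrite subKr.
have -> : z0.1 + (D + s) = z1.1 + s by rewrite addrA subrKC.
have -> : gx z1 = w + mu *: D + gx z0 by rewrite /w !subrK.
have kw : (L - mu) * k ^+ 2 * inner w w = k * inner w w.
  by rewrite expr2 mulrA divff ?mul1r// subr_eq0 gt_eqF.
have -> : 1 / (2 * (L - mu)) = k / 2 by rewrite /k mul1r invfM mulrC.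
rewrite {}/s; clearbody w D E; rewrite !innerE (innerC D w); move: kw.
by lra.
Qed.

End Saddle.

Section Swap.
Context {R : realType} {dx dy : nat}.
Implicit Types (f : 'rV[R]_dx * 'rV[R]_dy -> R) (z : 'rV[R]_dx * 'rV[R]_dy).
Implicit Types (gx : 'rV[R]_dx * 'rV[R]_dy -> 'rV[R]_dx).
Implicit Types (gy : 'rV[R]_dx * 'rV[R]_dy -> 'rV[R]_dy).

Lemma gradient_selection_swap f gx gy : gradient_selection f gx gy ->
  gradient_selection (fun p => - f (swap p))
    (fun p => - gy (swap p)) (fun p => - gx (swap p)).
Proof.
move=> fg -[y x]; have [hx hy] := fg (x, y); split=> [y'|x'] /=.
  by rewrite innerNl -opprD lerN2; exact: hy.
by rewrite innerNl -opprD lerN2; exact: hx.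
Qed.

Lemma innerp_swap z w : innerp (swap z) (swap w) = innerp z w.
Proof. by rewrite /innerp addrC. Qed.

Lemma l2normp_swap z : l2normp (swap z) = l2normp z.
Proof. by rewrite /l2normp innerp_swap. Qed.

(** The swapped problem has operator [(- gy, gx)], the old one with its blocks exchanged, so
    monotonicity and the Lipschitz bound carry over with the same constants. *)
Lemma operator_swap gx gy z w :
  operator (fun p => - gy (swap p)) (fun p => - gx (swap p)) (swap w)
  - operator (fun p => - gy (swap p)) (fun p => - gx (swap p)) (swap z)
  = swap (operator gx gy w - operator gx gy z).
Proof. by case: z w => [x y] [x' y']; rewrite /operator /= !opprK. Qed.

(** Exchanging the points undoes the sign of [- f] and keeps [gx] evaluated at [z0] and [gy] at
    [z1]. *)
Lemma gap_swap f gx gy z0 z1 :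
  gap (fun p => - f (swap p)) (fun p => - gy (swap p)) (fun p => - gx (swap p))
    (swap z0) (swap z1) = gap f gx gy z1 z0.
Proof.
case: z0 z1 => [x y] [x' y']; rewrite /gap /=.
rewrite -(opprB x') -(opprB y') !(innerNl, innerNr); ring.
Qed.

End Swap.

Theorem theorem7 (R : realType) (dx dy : nat) (mu L : R)
    (mu_gt0 : 0 < mu) (mu_lt_L : mu < L)
    (f : 'rV[R]_dx * 'rV[R]_dy -> R) (fS : S_class mu L f)
    (gx : 'rV[R]_dx * 'rV[R]_dy -> 'rV[R]_dx)
    (gy : 'rV[R]_dx * 'rV[R]_dy -> 'rV[R]_dy)
    (fg : gradient_selection f gx gy)
    (z0 z1 : 'rV[R]_dx * 'rV[R]_dy) :
  [/\ 0 >= l2normp (operator gx gy z1 - operator gx gy z0) ^+ 2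
           - L ^+ 2 * l2normp (z1 - z0) ^+ 2,
      gap f gx gy z1 z0 >= mu / 2 * l2normp (z1 - z0) ^+ 2,
      gap f gx gy z1 z0 >=
        1 / (2 * (L - mu))
          * l2norm (gx z1 - gx z0 - mu *: (z1.1 - z0.1)) ^+ 2
        + mu / 2 * l2norm (z1.1 - z0.1) ^+ 2
        - L / 2 * l2norm (z1.2 - z0.2) ^+ 2
    & gap f gx gy z1 z0 >=
        1 / (2 * (L - mu))
          * l2norm (gy z1 - gy z0 + mu *: (z1.2 - z0.2)) ^+ 2
        + mu / 2 * l2norm (z1.2 - z0.2) ^+ 2
        - L / 2 * l2norm (z1.1 - z0.1) ^+ 2].
Proof.
have [_ /(_ gx gy fg) g_mono /(_ gx gy fg) g_lip] := fS.
have fg' := gradient_selection_swap _ _ _ fg.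
pose g' := operator (fun p => - gy (swap p)) (fun p => - gx (swap p)).
have g'E z w : g' (swap w) - g' (swap z) = swap (operator gx gy w - operator gx gy z).
  exact: operator_swap.
have g_mono' (z w : 'rV[R]_dy * 'rV[R]_dx) :
    mu * l2normp (w - z) ^+ 2 <= innerp (g' w - g' z) (w - z).
  have -> : w - z = swap (swap w - swap z) by case: w z => [? ?] [].
  rewrite l2normp_swap; case: z w => [y x] [y' x'].
  by rewrite (g'E (x, y) (x', y')) innerp_swap; exact: g_mono.
have g_lip' (z w : 'rV[R]_dy * 'rV[R]_dx) :
    l2normp (g' w - g' z) <= L * l2normp (w - z).
  have -> : w - z = swap (swap w - swap z) by case: w z => [? ?] [].
  rewrite l2normp_swap; case: z w => [y x] [y' x'].
  by rewrite (g'E (x, y) (x', y')) l2normp_swap; exact: g_lip.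
split.
- rewrite subr_le0; exact: (sqr_operator_lip mu_gt0 mu_lt_L g_lip).
(* Strong convexity from [z0] and strong concavity from [z1] are both taken to the corner
   [(z1.1, z0.2)]; its value cancels in the sum, which leaves the gap. *)
- have := strong_convexity_x fg g_mono z0 (z1.1 - z0.1).
  have := strong_convexity_x fg' g_mono' (swap z1) (z0.2 - z1.2).
  rewrite /swap /= !subrKC -!surjective_pairing sqr_l2normp /gap -[z0.2 - z1.2]opprB.
  by rewrite /= !(innerNl, innerNr); lra.
- exact: (gap_ge_x mu_gt0 mu_lt_L fg g_mono g_lip).
have := gap_ge_x mu_gt0 mu_lt_L fg' g_mono' g_lip' (swap z1) (swap z0).
rewrite gap_swap !sqr_l2norm /swap /= -!surjective_pairing; apply: le_trans.
rewrite -[z0.2 - z1.2]opprB -[z0.1 - z1.1]opprB scalerN !opprK.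
by rewrite [- _ + gy z1]addrC !(innerNl, innerNr) !opprK.
Qed.
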